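(* Let $n=n_1+n_2+n_3=p+q$ with $\min(n_1,n_2,n_3)\ge 2$, $p=2$ and $q=n-2$. Let $G=U(n)$, and let $L=U(n_1)\times U(n_2)\times U(n_3)$ and $H=U(p)\times U(q)$ be the natural block-diagonal subgroups of $G$. Define the abelian subspaces of $\mathfrak{u}(n)$ $$\mathfrak a_1:=\mathbb{R}(E_{1,n}-E_{n,1})+\mathbb{R}(E_{2,n-1}-E_{n-1,2}),\quad \mathfrak a':=\mathbb{R}(E_{n_1+1,n-1}-E_{n-1,n_1+1}),$$ $$\mathfrak a_2:=\mathbb{R}(E_{n_1+1,n}-E_{n,n_1+1})+\mathbb{R}(E_{n_1+2,n-1}-E_{n-1,n_1+2}),$$ the toral subgroups $A_1:=\exp\mathfrak a_1$, $A':=\exp\mathfrak a'$, $A_2:=\exp\mathfrak a_2$ of $O(n)$, and the subset $B:=A_2A'A_1=\{xyz:x\in A_2,y\in A',z\in A_1\}\subset O(n)$. Then $G=LBH$.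
   Context: $E_{ij}$ denotes the $n\times n$ matrix unit with $1$ in position $(i,j)$ and $0$ elsewhere. $LBH=\{xbh:x\in L,b\in B,h\in H\}$. *)

(* Defs.v *)
From HB Require Import structures.
From mathcomp Require Import all_boot all_order all_algebra.
From mathcomp Require Import all_classical all_reals all_analysis.
From mathcomp Require Import complex.
Set Implicit Arguments. Unset Strict Implicit. Unset Printing Implicit Defensive.
Import Order.TTheory GRing.Theory Num.Theory.
Local Open Scope classical_set_scope.
Local Open Scope ring_scope.

Definition unitary (C : numClosedFieldType) (n : nat) (A : 'M[C]_n) : Prop :=
  A *m (map_mx Num.conj A)^T = 1%:M.

Definition mxexp (R : realType) (n : nat) (A : 'M[R]_n) : 'M[R]_n :=
  lim (series (fun k : nat => (k`!%:R)^-1 *: iter k (mulmx A) 1%:M) @ \oo).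

(* rotgen n a b = E_{a+1,b+1} - E_{b+1,a+1}  (a, b are 0-based indices). *)
Definition rotgen (R : pzRingType) (n a b : nat) : 'M[R]_n :=
  \matrix_(i, j) (((i == a :> nat) && (j == b :> nat))%:R
                  - ((i == b :> nat) && (j == a :> nat))%:R).

Definition blk3 (n1 n2 : nat) (i : nat) : nat :=
  if (i < n1)%N then 0 else if (i < n1 + n2)%N then 1 else 2.

Definition blk2 (i : nat) : nat := if (i < 2)%N then 0 else 1.

Definition inL (R : realType) (n1 n2 n3 : nat) (A : 'M[R[i]]_(n1 + n2 + n3)) : Prop :=
  unitary A /\ forall i j : 'I_(n1 + n2 + n3), blk3 n1 n2 i != blk3 n1 n2 j -> A i j = 0.

Definition inH (R : realType) (n : nat) (A : 'M[R[i]]_n) : Prop :=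
  unitary A /\ forall i j : 'I_n, blk2 i != blk2 j -> A i j = 0.

Section Tori.
Variables (R : realType) (n1 n2 n3 : nat).
Local Notation n := (n1 + n2 + n3)%N.

Definition gen_a1_1 : 'M[R]_n := rotgen R n 0 (n - 1).
Definition gen_a1_2 : 'M[R]_n := rotgen R n 1 (n - 2).
Definition gen_a' : 'M[R]_n := rotgen R n n1 (n - 2).
Definition gen_a2_1 : 'M[R]_n := rotgen R n n1 (n - 1).
Definition gen_a2_2 : 'M[R]_n := rotgen R n n1.+1 (n - 2).

Definition A1 : set 'M[R]_n :=
  [set mxexp (s *: gen_a1_1 + t *: gen_a1_2) | s in [set: R] & t in [set: R]].
Definition A' : set 'M[R]_n := [set mxexp (s *: gen_a') | s in [set: R]].
Definition A2 : set 'M[R]_n :=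
  [set mxexp (s *: gen_a2_1 + t *: gen_a2_2) | s in [set: R] & t in [set: R]].

Definition Bset : set 'M[R]_n :=
  fun M => exists x y z, A2 x /\ A' y /\ A1 z /\ M = x *m y *m z.
End Tori.

(* Main.v *)
(** Modulo [H] on the right, a unitary [g] is remembered only through the [n x 2]
isometry [X] of its first two columns, up to right multiplication by [U(2)]; modulo
[L] on the left, [X] is remembered only through the Gram matrices of its three row
blocks, which are positive semidefinite with sum [1]. A unitary change of basis
diagonalizes the first Gram matrix, and a phase then makes the second one real, so
that the Gram matrices are [diag(p0, p1)], [[a, r; r, d]] and their complement. The
first two columns of an element of [B] produce exactly such triples, and the five
angles can be solved for: the inequalities [r^2 <= a d] and
[r^2 <= (1 - p0 - a) (1 - p1 - d)] are what makes the sines and cosines bounded by 1. *)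
Require Import Defs.
From HB Require Import structures.
From mathcomp Require Import all_boot all_order all_algebra.
From mathcomp Require Import all_classical all_reals all_analysis.
From mathcomp Require Import complex.
From mathcomp Require Import ring lra zify.
Import Order.TTheory GRing.Theory Num.Theory.
Import numFieldNormedType.Exports.
Local Open Scope ring_scope.
Set Implicit Arguments. Unset Strict Implicit. Unset Printing Implicit Defensive.

(** * Matrix exponentials *)

(* By Rodrigues' formula, [exp (s *: J) = 1%:M + rod J s] when [J^3 = - J]. *)
Definition rod (R : realType) (n : nat) (J : 'M[R]_n) (s : R) : 'M[R]_n :=
  sin s *: J + (1 - cos s) *: (J *m J).

Section MatrixExponential.
Local Open Scope classical_set_scope.
Variables (R : realType) (n : nat) (J K : 'M[R]_n).
Hypotheses (J3 : J *m (J *m J) = - J) (K3 : K *m (K *m K) = - K).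
Hypotheses (JK : J *m K = 0) (KJ : K *m J = 0).

(** Since [J^3 = - J], the powers of [J] run through [J], [J^2], [-J], [-J^2], likewise for [K], and
    mixed products vanish. At [k = 0] the cosine terms contribute [- J^2 - K^2]; the matrix
    [1 + J^2 + K^2], annihilated by [J] and by [K], compensates for this. *)
Lemma mxexp_term (s t : R) (k : nat) :
  (k`!%:R)^-1 *: iter k (mulmx (s *: J + t *: K)) 1%:M =
  (k == 0)%:R *: (1%:M + J *m J + K *m K)
  + (sin_coeff s k *: J - cos_coeff s k *: (J *m J))
  + (sin_coeff t k *: K - cos_coeff t k *: (K *m K)).
Proof.
(* [c] and [d] are the cosine and sine coefficients multiplied by [k!], which turns the induction
   into two recurrences without denominators. *)
pose c (x : R) k := (~~ odd k)%:R * (-1) ^+ k./2 * x ^+ k.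
pose d (x : R) k := (odd k)%:R * (-1) ^+ k.-1./2 * x ^+ k.
have cS x m : c x m.+1 = - (x * d x m).
  by case: m => [|m]; rewrite /c /d /= ?negbK ?exprS ?mul0r ?mulr0 ?oppr0 //; ring.
have dS x m : d x m.+1 = x * c x m.
  by rewrite /c /d /= exprS; ring.
have E : iter k (mulmx (s *: J + t *: K)) 1%:M =
  (k == 0)%:R *: (1%:M + J *m J + K *m K)
  + (d s k *: J - c s k *: (J *m J)) + (d t k *: K - c t k *: (K *m K)).
  elim: k => [|k IH].
    rewrite /c /d /=; move: (J *m J) (K *m K) => P Q.
    by apply/matrixP => i j; rewrite !mxE; ring.
  have z : (k.+1 == 0)%:R = 0 :> R by [].
  rewrite iterS IH z scale0r add0r.
  have JJ x y : J *m (x *: J - y *: (J *m J)) = x *: (J *m J) + y *: J.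
    by rewrite mulmxBr -!scalemxAr J3 scalerN opprK.
  have KK x y : K *m (x *: K - y *: (K *m K)) = x *: (K *m K) + y *: K.
    by rewrite mulmxBr -!scalemxAr K3 scalerN opprK.
  have JKe x y : J *m (x *: K - y *: (K *m K)) = 0.
    by rewrite mulmxBr -!scalemxAr mulmxA JK mul0mx !scaler0 subr0.
  have KJe x y : K *m (x *: J - y *: (J *m J)) = 0.
    by rewrite mulmxBr -!scalemxAr mulmxA KJ mul0mx !scaler0 subr0.
  have J1 : J *m (1%:M + J *m J + K *m K) = 0.
    by rewrite !mulmxDr J3 mulmx1 subrr add0r mulmxA JK mul0mx.
  have K1 : K *m (1%:M + J *m J + K *m K) = 0.
    by rewrite !mulmxDr K3 mulmx1 (mulmxA _ J) KJ mul0mx addr0 subrr.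
  have D3 (M X Y Z : 'M[R]_n) : M *m (X + Y + Z) = M *m X + M *m Y + M *m Z.
    by rewrite !mulmxDr.
  rewrite mulmxDl -!scalemxAl (D3 J (_ *: _)) (D3 K (_ *: _)) JJ KK JKe KJe.
  rewrite -!scalemxAr J1 K1.
  rewrite !scaler0 !add0r addr0 !cS !dS.
  by rewrite !scaleNr !opprK !scalerDr !scalerA [_ + _ *: J]addrC [_ + _ *: K]addrC.
rewrite E; move: (1%:M + _ + _) => D; rewrite !scalerDr !scalerN !scalerA.
congr (_ *: _ + (_ *: _ - _ *: _) + (_ *: _ - _ *: _)).
  by case: k {E} => [|k]; rewrite ?fact0 ?invr1 ?mulr1 //= mulr0.
all: by rewrite mulrC.
Qed.

Lemma series_delta0 :
  (series (fun k => (k == 0)%:R : R)) @ \oo --> (1 : R).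
Proof.
rewrite -cvg_shiftS; apply: cvg_near_cst; apply: nearW => k.
by rewrite /series /= big_nat_recl // big1 ?addr0.
Qed.

Lemma mxexp_rodrigues2 (s t : R) :
  mxexp (s *: J + t *: K) = 1%:M + rod J s + rod K t.
Proof.
rewrite /mxexp /rod; apply/cvg_lim => //.
pose D := 1%:M + J *m J + K *m K.
(* Splitting [1 - cos] moves the squares of [J] and [K] into [D] and gives the limit the shape of
   the partial sums. *)
have -> : 1%:M + (sin s *: J + (1 - cos s) *: (J *m J))
   + (sin t *: K + (1 - cos t) *: (K *m K)) =
  1 *: D + (sin s *: J - cos s *: (J *m J)) + (sin t *: K - cos t *: (K *m K)).
  rewrite /D; move: (J *m J) (K *m K) => P Q.
  by apply/matrixP => i j; rewrite !mxE; ring.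
have cs (x : R) : series (cos_coeff x) @ \oo --> cos x.
  by rewrite unlock; exact: is_cvg_series_cos_coeff.
have sn (x : R) : series (sin_coeff x) @ \oo --> sin x.
  by rewrite unlock; exact: is_cvg_series_sin_coeff.
set u := series _.
have -> : u = (fun N => series (fun k => (k == 0)%:R) N *: D
     + (series (sin_coeff s) N *: J - series (cos_coeff s) N *: (J *m J))
     + (series (sin_coeff t) N *: K - series (cos_coeff t) N *: (K *m K))).
  apply/funext => N; rewrite /u /series /= (eq_bigr _ (fun k _ => mxexp_term s t k)).
  by rewrite !(big_split, sumrN, scaler_suml) /=.
apply: cvgD; [apply: cvgD|]; [|apply: cvgB|apply: cvgB]; apply: cvgZr_tmp => //.
exact: series_delta0.
Qed.

Hypotheses (JT : J^T = - J) (KT : K^T = - K).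

Lemma rodT (L : 'M[R]_n) (s : R) : (rod L s)^T = rod L^T s.
Proof. by rewrite /rod linearD !linearZ /= trmx_mul. Qed.

(** The cross terms vanish with [J *m K] and [K *m J]. Each remaining [a^T + a + a^T *m a] is a
    multiple of the square of the generator with the factor [1 - (cos^2 + sin^2)]. *)
Lemma rod_orthogonal (s t : R) :
  (1%:M + rod J s + rod K t)^T *m (1%:M + rod J s + rod K t) = 1%:M.
Proof.
have E (L : 'M[R]_n) x : L *m (L *m L) = - L -> L^T = - L ->
    (rod L x)^T + rod L x + (rod L x)^T *m rod L x = 0.
  move=> L3 LT; rewrite rodT.
  have L4 : L *m L *m (L *m L) = - (L *m L) by rewrite -mulmxA L3 mulmxN.
  have L3' : L *m L *m L = - L by rewrite -mulmxA.
  rewrite /rod LT mulmxDl !mulmxDr -!scalemxAl -!scalemxAr !(mulNmx, mulmxN) !opprK L3 L3' L4.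
  have := cos2Dsin2 x; move: (sin x) (cos x) (L *m L) => a b M ab.
  apply/matrixP => i j; rewrite !mxE.
  transitivity ((1 - (b ^+ 2 + a ^+ 2)) * M i j); last by rewrite ab subrr mul0r.
  by ring.
have Z (L N : 'M[R]_n) x y : L *m N = 0 -> L^T = - L -> (rod L x)^T *m rod N y = 0.
  move=> LN LT; have z : L^T *m rod N y = 0.
    by rewrite /rod LT mulNmx mulmxDr -!scalemxAr mulmxA LN mul0mx !scaler0 addr0 oppr0.
  have LTN : L^T *m (L^T *m rod N y) = 0 by rewrite z mulmx0.
  by rewrite rodT {1}/rod mulmxDl -!scalemxAl -mulmxA LTN z !scaler0 addr0.
have := Z K J t s KJ KT; have := Z J K s t JK JT.
have := E K t K3 KT; have := E J s J3 JT.
move: (rod J s) (rod K t) => a b aa bb ab ba.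
have -> : (1%:M + a + b)^T = 1%:M + a^T + b^T by rewrite !linearD /= trmx1.
rewrite !mulmxDl !mul1mx !mulmxDr !mulmx1 ab ba !addr0.
transitivity (1%:M + (a^T + a + a^T *m a) + (b^T + b + b^T *m b)); last first.
  by rewrite aa bb !addr0.
by apply/matrixP => i j; rewrite !mxE; ring.
Qed.
End MatrixExponential.

(** * Gram matrices *)

Section Gram.
Local Open Scope sesquilinear_scope.
Variable C : numClosedFieldType.

Lemma adjmxM m n p (A : 'M[C]_(m, n)) (B : 'M[C]_(n, p)) : (A *m B)^t* = B^t* *m A^t*.
Proof. by rewrite trmx_mul map_mxM. Qed.

Lemma adjmxD m n (A B : 'M[C]_(m, n)) : (A + B)^t* = A^t* + B^t*.
Proof. by apply/matrixP => i j; rewrite !mxE rmorphD. Qed.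

Lemma mulmx_adj_eq0 m n (A : 'M[C]_(m, n)) : A *m A^t* = 0 -> A = 0.
Proof.
move=> A0; apply/matrixP => i j; rewrite mxE.
have /matrixP/(_ i i) := A0; rewrite !mxE => /eqP.
rewrite psumr_eq0 => [/allP/(_ j)|k _]; last by rewrite !mxE mul_conjC_ge0.
by rewrite mem_index_enum !mxE mul_conjC_eq0 => /(_ isT)/eqP.
Qed.

(** The equality [p = m] is a hypothesis so that [W] may be a stack with [r + (m - r)] rows. *)
Lemma unitarymx_adjmul p m (W : 'M[C]_(p, m)) :
  p = m -> W \is unitarymx -> W^t* *m W = 1%:M.
Proof. by move=> e; case: _ / e W => W /unitarymxP/mulmx1C. Qed.

(** Gram-Schmidt on the orthogonal complement of the rows of [S] gives [N]; the stack of [S] and [N]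
    is a square unitary matrix, and its left inverse property is the last equation. *)
Lemma unitarymx_completion r m (S : 'M[C]_(r, m)) : S \is unitarymx ->
  exists N : 'M[C]_(m - r, m),
    [/\ N *m N^t* = 1%:M, S *m N^t* = 0 & S^t* *m S + N^t* *m N = 1%:M].
Proof.
move=> Su; have rS := mxrank_unitary Su.
have [N Nu SN] : exists2 N : 'M[C]_(m - r, m), N \is unitarymx & S *m N^t* = 0.
  rewrite -[in (m - r)%N]rS -rank_ortho.
  exists (schmidt (row_base (orthomx Num.conj 1%:M S))).
    by rewrite schmidt_unitarymx // rank_leq_col.
  apply/orthomx1P; rewrite orthomx_sym eqmx_schmidt_free ?eq_row_base //.
  by rewrite row_base_free.
exists N; split => //; first exact/unitarymxP.
have NS : N *m S^t* = 0 by rewrite -[N]trmxCK -adjmxM SN trmx0 map_mx0.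
have Wu : col_mx S N \is unitarymx.
  apply/unitarymxP; rewrite tr_col_mx map_row_mx mul_col_row SN NS.
  by rewrite !(unitarymxP _) // -scalar_mx_block.
rewrite -mul_row_col -map_row_mx -tr_col_mx unitarymx_adjmul //.
by rewrite subnKC // -rS rank_leq_col.
Qed.

(** Equal Gram matrices make rows of [A] and [B] obey the same linear relations. The same
    coefficients therefore turn both into orthonormal families [S] and [S'] of equal size, and
    completing these yields the unitary that carries [B] to [A]. *)
Lemma eq_gram_unitary k m (A B : 'M[C]_(k, m)) :
  A *m A^t* = B *m B^t* -> exists2 U : 'M[C]_m, U \is unitarymx & A = B *m U.
Proof.
move=> AB.
have [D AD] : exists D, row_base A = D *m A by apply/submxP; rewrite eq_row_base.
have fA := row_base_free A; have eA := mulmx_base A.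
set r := \rank A in D AD fA eA *; set E := col_base A in eA.
set A0 := row_base A in AD fA eA.
(* The relation [(1 - E D) A = 0] passes to [B], because [(1 - E D) B B^t*] equals
   [(1 - E D) A A^t*]. *)
have eB : B = E *m (D *m B).
  apply/eqP; rewrite -subr_eq0 mulmxA -[X in X - _]mul1mx -mulmxBl; apply/eqP.
  have A0E : (1%:M - E *m D) *m A = 0 by rewrite mulmxBl mul1mx -mulmxA -AD eA subrr.
  apply: mulmx_adj_eq0; rewrite adjmxM mulmxA -(mulmxA _ B) -AB.
  by rewrite mulmxA A0E !mul0mx.
have rm : (r <= m)%N by apply: rank_leq_col.
have [T AT] : exists T, A0 = T *m schmidt A0 by apply/submxP; exact: schmidt_sub.
have Su := schmidt_unitarymx A0 rm.
set S := schmidt A0 in AT Su.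
have Tu : T \in unitmx.
  rewrite -row_free_unit -row_leq_rank; move: fA.
  rewrite -row_leq_rank => /leq_trans; apply.
  by rewrite AT mxrankM_maxl.
have SE : S = invmx T *m A0 by rewrite AT mulKmx.
pose S' := invmx T *m (D *m B).
(* [S] and [S'] arise from [A] and [B] by the same left factor, so their Gram matrices agree. *)
have S'u : S' \is unitarymx.
  have FA : S = (invmx T *m D) *m A by rewrite -mulmxA -AD.
  have FB : S' = (invmx T *m D) *m B by rewrite -mulmxA.
  apply/unitarymxP; rewrite -(unitarymxP Su) FA FB.
  by rewrite (adjmxM _ A) (adjmxM _ B) -!mulmxA !(mulmxA A) !(mulmxA B) AB.
have eBT : B = E *m (T *m S') by rewrite {1}eB mulKVmx.
clearbody S S'.
have [N [N1 SN NS]] := unitarymx_completion Su.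
have [N' [N'1 SN' NS']] := unitarymx_completion S'u.
have NS0 : N' *m S'^t* = 0 by rewrite -[N']trmxCK -adjmxM SN' trmx0 map_mx0.
(* Right multiplication by this matrix sends the rows of [S'] to those of [S] and the rows of [N']
   to those of [N]. *)
exists (S'^t* *m S + N'^t* *m N).
  rewrite -trmxC_unitary; apply/unitarymxP; rewrite trmxCK.
  rewrite adjmxD !adjmxM !trmxCK mulmxDl !mulmxDr !mulmxA.
  rewrite -!(mulmxA _ S') -!(mulmxA _ N') N'1 SN' NS0 (unitarymxP S'u).
  by rewrite !mulmx1 !mulmx0 !mul0mx addr0 add0r.
rewrite -[LHS]eA AT [in RHS]eBT -!mulmxA; congr (_ *m (_ *m _)).
by rewrite mulmxDr !mulmxA SN' (unitarymxP S'u) mul1mx mul0mx addr0.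
Qed.
End Gram.

(** * Solving for the angles *)

Section Angles.
Variable R : realType.
Implicit Types x y p r : R.

(** The angle [acos x] has sine [|y|]; it is negated when [y] is negative. *)
Lemma circle_angle x y : x ^+ 2 + y ^+ 2 = 1 -> exists t : R, cos t = x /\ sin t = y.
Proof.
move=> xy.
have x1 : -1 <= x <= 1 by apply/andP; split; nra.
have c : cos (acos x) = x by rewrite acosK // in_itv.
have s : sin (acos x) = `|y|.
  by rewrite sin_acos // -sqrtr_sqr; congr Num.sqrt; rewrite -xy; ring.
have [y0|y0] := ger0P y.
  by exists (acos x); rewrite s ger0_norm.
by exists (- acos x); rewrite cosN sinN s ltr0_norm // opprK.
Qed.

Lemma sqr_angle p : 0 <= p <= 1 ->
  exists t : R, cos t ^+ 2 = p /\ sin t ^+ 2 = 1 - p.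
Proof.
move=> /andP[p0 p1].
have [|t [ct st]] := @circle_angle (Num.sqrt p) (Num.sqrt (1 - p)).
  by rewrite !sqr_sqrtr ?subr_ge0 // addrC subrK.
by exists t; rewrite ct st !sqr_sqrtr ?subr_ge0.
Qed.

(** The left-hand sides are the Gram entries, in the first two row blocks, of the first two columns
    of an element of [B]. The system is triangular: [s0] and [s1] come from [p0] and [p1], then [tu]
    from [a], [tr] from [r], and [tv] from [d]. *)
Lemma torus_angles p0 p1 a d r :
  0 <= p0 -> 0 <= p1 -> 0 <= a -> 0 <= d -> 0 <= 1 - p0 - a -> 0 <= 1 - p1 - d ->
  r ^+ 2 <= a * d -> r ^+ 2 <= (1 - p0 - a) * (1 - p1 - d) ->
  exists s0 s1 tr tu tv : R,
  [/\ cos s0 ^+ 2 = p0, cos s1 ^+ 2 = p1, (sin s0 * sin tu) ^+ 2 = a,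
      sin s0 * sin s1 * sin tu * cos tu * sin tr = r &
      sin s1 ^+ 2 * ((sin tr * cos tu) ^+ 2 + (cos tr * sin tv) ^+ 2) = d].
Proof.
move=> p0_ge0 p1_ge0 a0 d0 a1 d1 rad rad'.
have [|s0 [c0 ss0]] := @sqr_angle p0; first by apply/andP; split; lra.
have [|s1 [c1 ss1]] := @sqr_angle p1; first by apply/andP; split; lra.
exists s0, s1.
(* Division by 0 gives 0, so the bound survives [y = 0]; there [x = 0] too, so [fracK] holds as
   well. *)
have frac x y : 0 <= x -> x <= y -> 0 <= x / y <= 1.
  move=> x0 xy; have [->|y0] := eqVneq y 0.
    by rewrite invr0 mulr0 lexx ler01.
  have yp : 0 < y by rewrite lt_neqAle eq_sym y0 (le_trans x0).
  by rewrite divr_ge0 ?(ltW yp) //= ler_pdivrMr // mul1r.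
have fracK x y : 0 <= x -> x <= y -> y * (x / y) = x.
  move=> x0 xy; have [y0|y0] := eqVneq y 0; last by field.
  by rewrite y0 mul0r; apply/eqP; rewrite eq_le x0 -y0 xy.
have aS : a <= sin s0 ^+ 2 by rewrite ss0; lra.
have dS : d <= sin s1 ^+ 2 by rewrite ss1; lra.
have [tu [cu2 su2]] := sqr_angle
  (frac (sin s0 ^+ 2 - a) (sin s0 ^+ 2) ltac:(lra) ltac:(lra)).
have cu : sin s0 ^+ 2 * cos tu ^+ 2 = sin s0 ^+ 2 - a by rewrite cu2 fracK //; lra.
have su : sin s0 ^+ 2 * sin tu ^+ 2 = a by have := cos2Dsin2 tu; nra.
(* The equation for [tr] is [r = w * sin tr], so [r^2 <= w^2] has to be shown, with [w = 0] treated
   apart. *)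
pose w := sin s0 * sin s1 * sin tu * cos tu.
have wE : sin s0 ^+ 2 * w ^+ 2 = a * (sin s0 ^+ 2 - a) * sin s1 ^+ 2.
  by rewrite -{1}su -cu /w; ring.
have [w0|w0] := eqVneq w 0.
  have r0 : r = 0.
    (* Each vanishing factor kills one of the two bounds on [r^2]; in the first case [d = 0] because
       [d <= sin s1 ^+ 2]. *)
    have : (sin s1 ^+ 2 == 0) || (a == 0) || (sin s0 ^+ 2 - a == 0).
      by rewrite -!mulf_eq0 -mulrA [X in X == 0]mulrC -wE w0 expr0n mulr0.
    move=> h; suff r2 : r ^+ 2 <= 0 by nra.
    by case/orP: h => [/orP[]|] /eqP h; nra.
  have [tv [_ sv]] := sqr_angle
  (frac (sin s1 ^+ 2 - d) (sin s1 ^+ 2) ltac:(lra) ltac:(lra)).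
  exists 0, tu, tv; rewrite sin0 cos0 !mulr0 mul0r mul1r exprMn; split => //.
  by rewrite expr0n add0r sv mulrBr mulr1 fracK //; lra.
have S0p : 0 < sin s0 ^+ 2.
  rewrite lt_neqAle sqr_ge0 eq_sym sqrf_eq0 andbT; apply: contraNneq w0 => z.
  by rewrite /w z !mul0r.
have ap : 0 < a.
  rewrite lt_neqAle a0 eq_sym andbT; apply: contraNneq w0 => z.
  have /eqP : sin s0 ^+ 2 * sin tu ^+ 2 = 0 by rewrite su z.
  by rewrite mulf_eq0 !sqrf_eq0 /w => /orP[]/eqP->; rewrite !(mul0r, mulr0).
have bp : 0 < sin s0 ^+ 2 - a.
  rewrite lt_neqAle eq_sym -cu mulr_ge0 ?sqr_ge0 // andbT; apply: contraNneq w0 => /eqP.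
  by rewrite mulf_eq0 !sqrf_eq0 /w => /orP[]/eqP->; rewrite !(mul0r, mulr0).
(* [a r^2 <= a (S0 - a) (S1 - d)] and [(S0 - a) r^2 <= (S0 - a) a d] add up to
   [S0 r^2 <= S0 w^2], where [Si = sin si ^+ 2]. *)
have rw : r ^+ 2 <= w ^+ 2.
  have h1 := ler_wpM2r (ltW bp) rad.
  have h2 := ler_wpM2l (ltW ap) rad'.
  rewrite -(ler_pM2l S0p) wE; rewrite -ss0 -ss1 in h2; nra.
have [|tr [ctr str]] := @circle_angle (Num.sqrt (1 - (r / w) ^+ 2)) (r / w).
  rewrite sqr_sqrtr ?subrK // subr_ge0 exprMn exprVn ler_pdivrMr ?mul1r //.
  by rewrite lt_neqAle sqr_ge0 eq_sym sqrf_eq0 w0.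
have rE : r = w * sin tr by rewrite str; field.
(* [D] is the part of [d] left for [tv]. After multiplication by [a], [0 <= D] becomes [r^2 <= a d];
   after multiplication by [sin s0 ^+ 2 - a], the upper bound [D1] becomes the other bound on
   [r^2]. *)
pose D := d - sin s1 ^+ 2 * (sin tr * cos tu) ^+ 2.
have D0 : 0 <= D.
  rewrite -(pmulr_rge0 _ ap) /D mulrBr subr_ge0 (le_trans _ rad) //.
  by rewrite rE /w -[in leLHS]su le_eqVlt; apply/orP; left; apply/eqP; ring.
have D1 : D <= sin s1 ^+ 2 * cos tr ^+ 2.
  rewrite -subr_ge0 -(pmulr_rge0 _ bp).
  have h : r ^+ 2 = (sin s0 ^+ 2 - a) * (sin s1 ^+ 2 * (sin tr * sin tu) ^+ 2).
    by rewrite rE /w -cu; ring.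
  have -> : sin s1 ^+ 2 * cos tr ^+ 2 - D =
     (sin s1 ^+ 2 - d) - sin s1 ^+ 2 * (sin tr * sin tu) ^+ 2.
    by rewrite /D [cos tr ^+ 2]cos2sin2 !(exprMn _ (sin tr)) (cos2sin2 tu); ring.
  by rewrite mulrBr -h subr_ge0; rewrite -ss0 -ss1 in rad'.
have [tv [_ sv]] := sqr_angle
  (frac (sin s1 ^+ 2 * cos tr ^+ 2 - D) (sin s1 ^+ 2 * cos tr ^+ 2)
    ltac:(lra) ltac:(lra)).
have svD : sin s1 ^+ 2 * (cos tr * sin tv) ^+ 2 = D.
  by rewrite exprMn mulrA sv mulrBr mulr1 fracK; lra.
exists tr, tu, tv; split => //; first by rewrite exprMn.
by rewrite mulrDr svD addrC subrK.
Qed.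
End Angles.

(** * Products of torus elements *)

Section Rotations.
Variables (R : realType) (n : nat).

(* [ev m k] is the zero vector when [m <= k]. *)
Definition ev (m k : nat) : 'cV[R]_m := \col_i (i == k :> nat)%:R.

Local Notation e := (ev n).
Local Notation J := (rotgen R n).

Lemma ev_dot (m a b : nat) : (a < m)%N -> (ev m a)^T *m ev m b = (a == b)%:R%:M.
Proof.
move=> am; apply/matrixP => i j; rewrite !mxE !ord1 mulr1n (bigD1 (Ordinal am)) //=.
rewrite !mxE eqxx mul1r big1 ?addr0 // => k; rewrite -val_eqE /= => /negPf ka.
by rewrite !mxE ka mul0r.
Qed.

Lemma rotgenE a b : J a b = e a *m (e b)^T - e b *m (e a)^T.
Proof. by apply/matrixP => i j; rewrite !mxE !big_ord1 !mxE -!natrM !mulnb. Qed.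

Lemma rotgenT a b : (J a b)^T = - J a b.
Proof. by rewrite rotgenE linearB /= !trmx_mul !trmxK opprB. Qed.

Lemma rotgen_ev a b k : (a < n)%N -> (b < n)%N ->
  J a b *m e k = (b == k)%:R *: e a - (a == k)%:R *: e b.
Proof. by move=> an bn; rewrite rotgenE mulmxBl -!mulmxA !ev_dot // !mul_mx_scalar. Qed.

Lemma rotgen_sqr a b : (a < n)%N -> (b < n)%N -> a != b ->
  J a b *m J a b = - (e a *m (e a)^T) - e b *m (e b)^T.
Proof.
move=> an bn ab; rewrite [in X in _ *m X]rotgenE mulmxBr !mulmxA !rotgen_ev //.
rewrite !eqxx (negPf ab) eq_sym (negPf ab) !scale0r !scale1r sub0r subr0.
by rewrite mulNmx addrC.
Qed.

Lemma rotgen_cube a b : (a < n)%N -> (b < n)%N -> a != b ->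
  J a b *m (J a b *m J a b) = - J a b.
Proof.
move=> an bn ab; rewrite rotgen_sqr // mulmxBr mulmxN !mulmxA !rotgen_ev //.
rewrite !eqxx (negPf ab) eq_sym (negPf ab) !scale0r !scale1r sub0r subr0.
by rewrite mulNmx opprK rotgenE opprB.
Qed.

Lemma rotgen_mul0 a b c d : (a < n)%N -> (b < n)%N -> uniq [:: a; b; c; d] ->
  J a b *m J c d = 0.
Proof.
rewrite /= !inE !negb_or -!andbA => an bn /and5P[_ ac ad bc /andP[bd _]].
rewrite [J c d]rotgenE mulmxBr !mulmxA !rotgen_ev //.
by rewrite !(negPf ac, negPf ad, negPf bc, negPf bd) !scale0r !subrr !mul0mx subrr.
Qed.

(** [rod] is the plane rotation minus the identity, whence [cos s - 1]. *)
Lemma rod_rotgen_ev a b k s : (a < n)%N -> (b < n)%N -> a != b ->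
  rod (J a b) s *m e k =
  if k == a then (cos s - 1) *: e a - sin s *: e b else
  if k == b then (cos s - 1) *: e b + sin s *: e a else 0.
Proof.
move=> an bn ab; have ba : b == a = false by rewrite eq_sym (negPf ab).
rewrite /rod mulmxDl -!scalemxAl -mulmxA !rotgen_ev //.
rewrite mulmxBr -!scalemxAr !rotgen_ev // !eqxx (negPf ab) ba.
rewrite ![_ == k]eq_sym; have [->|ka] := eqVneq k a.
  by rewrite (negPf ab); apply/matrixP => i j; rewrite !mxE /=; ring.
by case: (k == b); apply/matrixP => i j; rewrite !mxE /=; ring.
Qed.

Lemma mxexp_rotgen2 a b c d s t :
  (a < n)%N -> (b < n)%N -> (c < n)%N -> (d < n)%N -> uniq [:: a; b; c; d] ->
  mxexp (s *: J a b + t *: J c d) = 1%:M + rod (J a b) s + rod (J c d) t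
  /\ (mxexp (s *: J a b + t *: J c d))^T *m mxexp (s *: J a b + t *: J c d) = 1%:M.
Proof.
move=> an bn cn dn u.
have u' : uniq [:: c; d; a; b] by rewrite (perm_uniq (permEl (perm_catC [:: c; d] [:: a; b]))).
have [ab cd] : a != b /\ c != d.
  by move: u; rewrite /= !inE !negb_or -!andbA => /and5P[-> _ _ _ /and3P[_ ->]].
have E : mxexp (s *: J a b + t *: J c d) = 1%:M + rod (J a b) s + rod (J c d) t.
  by apply: mxexp_rodrigues2; rewrite ?rotgen_cube ?rotgen_mul0.
split=> //; rewrite E.
by apply: rod_orthogonal; rewrite ?rotgen_cube ?rotgen_mul0 ?rotgenT.
Qed.

(** This is the case of two commuting generators with the second one equal to 0. *)
Lemma mxexp_rotgen a b s : (a < n)%N -> (b < n)%N -> a != b ->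
  mxexp (s *: J a b) = 1%:M + rod (J a b) s
  /\ (mxexp (s *: J a b))^T *m mxexp (s *: J a b) = 1%:M.
Proof.
move=> an bn ab; have r0 : rod (0 : 'M[R]_n) 0 = 0 by rewrite /rod mul0mx !scaler0 addr0.
have E : mxexp (s *: J a b) = 1%:M + rod (J a b) s.
  rewrite -[RHS]addr0 -r0 -mxexp_rodrigues2 ?mul0mx ?mulmx0 ?oppr0 ?rotgen_cube //.
  by rewrite scaler0 addr0.
split=> //; rewrite E -[1%:M + _]addr0 -r0.
by apply: rod_orthogonal; rewrite ?mul0mx ?mulmx0 ?oppr0 ?trmx0 ?rotgen_cube ?rotgenT.
Qed.

Lemma one_rod2_ev a b c d s t k :
  (a < n)%N -> (b < n)%N -> (c < n)%N -> (d < n)%N -> a != b -> c != d ->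
  (1%:M + rod (J a b) s + rod (J c d) t) *m e k = e k
  + (if k == a then (cos s - 1) *: e a - sin s *: e b else
     if k == b then (cos s - 1) *: e b + sin s *: e a else 0)
  + (if k == c then (cos t - 1) *: e c - sin t *: e d else
     if k == d then (cos t - 1) *: e d + sin t *: e c else 0).
Proof. by move=> *; rewrite mulmxDl [(1%:M + _) *m _]mulmxDl mul1mx !rod_rotgen_ev. Qed.

Lemma one_rod_ev a b s k : (a < n)%N -> (b < n)%N -> a != b ->
  (1%:M + rod (J a b) s) *m e k = e k
  + (if k == a then (cos s - 1) *: e a - sin s *: e b else
     if k == b then (cos s - 1) *: e b + sin s *: e a else 0).
Proof. by move=> *; rewrite [LHS]mulmxDl mul1mx rod_rotgen_ev. Qed.

(** A pair of rewrite rules, so that one bundle decides all index comparisons in either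
    orientation. *)
Lemma neqF (x y : nat) : x != y -> ((x == y) = false) * ((y == x) = false).
Proof. by move=> xy; rewrite [y == x]eq_sym !(negPf xy). Qed.

Section TorusProduct.
Variables (i0 i1 p0 p1 q0 q1 : nat).
Hypothesis lt_n : [&& i0 < n, i1 < n, p0 < n, p1 < n, q0 < n & q1 < n]%N.
Hypothesis neq : uniq [:: i0; i1; p0; p1; q0; q1].

(** An element of [A2 A' A1] over abstract indices; in the application [i0, i1] lie in the first
    block, [p0, p1] in the second and [q0, q1] in the third. *)
Definition torus_product (s0 s1 r u v : R) : 'M[R]_n :=
  mxexp (u *: J p0 q0 + v *: J p1 q1) *m mxexp (r *: J p0 q1)
  *m mxexp (s0 *: J i0 q0 + s1 *: J i1 q1).

(** The factors act from right to left: the first mixes each [i] with its [q], the middle one mixes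
    [q1] with [p0], the last mixes each [p] with its [q]. *)
Lemma torus_product_columns s0 s1 r u v : let b := torus_product s0 s1 r u v in
  [/\ b^T *m b = 1%:M,
      b *m e i0 = cos s0 *: e i0 - (sin s0 * sin u) *: e p0 - (sin s0 * cos u) *: e q0 &
      b *m e i1 = cos s1 *: e i1
        - (sin s1 * (sin r * cos u)) *: e p0 - (sin s1 * (cos r * sin v)) *: e p1
        + (sin s1 * (sin r * sin u)) *: e q0 - (sin s1 * (cos r * cos v)) *: e q1].
Proof.
have /and5P[i0n i1n p0n p1n /andP[q0n q1n]] := lt_n.
move: neq; rewrite /= !inE !negb_or -!andbA.
case/and5P=> /neqF h1 /neqF h2 /neqF h3 /neqF h4.
case/and5P=> /neqF h5 /neqF h6 /neqF h7 /neqF h8.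
case/and5P=> /neqF h9 /neqF h10 /neqF h11 /neqF h12 /and4P[/neqF h13 /neqF h14 /neqF h15 _].
have N := (h1, h2, h3, h4, h5, h6, h7, h8, h9, h10, h11, h12, h13, h14, h15).
have [|xE xO] := @mxexp_rotgen2 p0 q0 p1 q1 u v p0n q0n p1n q1n.
  by rewrite /= !inE !N.
have [|yE yO] := @mxexp_rotgen p0 q1 r p0n q1n; first by rewrite N.
have [|zE zO] := @mxexp_rotgen2 i0 q0 i1 q1 s0 s1 i0n q0n i1n q1n.
  by rewrite /= !inE !N.
rewrite /torus_product.
move: (mxexp (u *: _ + _)) (mxexp (r *: _)) (mxexp (s0 *: _ + _)) xE xO yE yO zE zO.
move=> X Y Z xE xO yE yO zE zO.
have Xe k := one_rod2_ev u v k p0n q0n p1n q1n; rewrite !N -xE in Xe.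
have Ye k := one_rod_ev r k p0n q1n; rewrite !N -yE in Ye.
have Ze k := one_rod2_ev s0 s1 k i0n q0n i1n q1n; rewrite !N -zE in Ze.
have lin (A B : 'M[R]_n) x y (a b : 'cV[R]_n) :
    A *m B *m (x *: a + y *: b) = x *: (A *m (B *m a)) + y *: (A *m (B *m b)).
  by rewrite mulmxDr -!scalemxAr !mulmxA.
have Ze0 : Z *m e i0 = cos s0 *: e i0 + (- sin s0) *: e q0.
  by rewrite Ze // eqxx !N; apply/matrixP => i j; rewrite !mxE; ring.
have Ze1 : Z *m e i1 = cos s1 *: e i1 + (- sin s1) *: e q1.
  by rewrite Ze // eqxx !N; apply/matrixP => i j; rewrite !mxE; ring.
have Yq1 : Y *m e q1 = cos r *: e q1 + sin r *: e p0.
  by rewrite Ye // eqxx !N; apply/matrixP => i j; rewrite !mxE; ring.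
have [Y0 Y1 Yq0] : [/\ Y *m e i0 = e i0, Y *m e i1 = e i1 & Y *m e q0 = e q0].
  by split; rewrite Ye // !N addr0.
have [X0 X1] : X *m e i0 = e i0 /\ X *m e i1 = e i1.
  by split; rewrite Xe // !N !addr0.
have Xp0 : X *m e p0 = cos u *: e p0 - sin u *: e q0.
  by rewrite Xe // eqxx !N; apply/matrixP => i j; rewrite !mxE; ring.
have Xq0 : X *m e q0 = cos u *: e q0 + sin u *: e p0.
  by rewrite Xe // eqxx !N; apply/matrixP => i j; rewrite !mxE; ring.
have Xq1 : X *m e q1 = cos v *: e q1 + sin v *: e p1.
  by rewrite Xe // eqxx !N; apply/matrixP => i j; rewrite !mxE; ring.
split.
- by rewrite !trmx_mul -!mulmxA (mulmxA _ X) xO mul1mx (mulmxA _ Y) yO mul1mx zO.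
- rewrite -[LHS]mulmxA Ze0 lin Y0 Yq0 X0 Xq0.
  by apply/matrixP => i j; rewrite !mxE; ring.
- rewrite -[LHS]mulmxA Ze1 lin Y1 Yq1 X1 mulmxDr -!scalemxAr Xq1 Xp0.
  by apply/matrixP => i j; rewrite !mxE; ring.
Qed.
End TorusProduct.
End Rotations.

(** * Normal form of the Gram matrices *)

Section TwoByTwo.
Local Open Scope sesquilinear_scope.

Definition sym2 (T : Type) (a b d : T) : 'M[T]_2 :=
  \matrix_(i, j) if i == j then (if i == 0 then a else d) else b.

Definition gram (C : numClosedFieldType) m n (X : 'M[C]_(m, n)) : 'M[C]_n := X^t* *m X.

Lemma ord2P (i : 'I_2) : i = 0 \/ i = 1.
Proof. by case: i => [[|[|//]] ip]; [left|right]; apply/val_inj. Qed.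

Lemma lift0_ord2 : lift ord0 ord0 = 1 :> 'I_2.
Proof. exact/val_inj. Qed.

Lemma matrix2P (T : Type) (A B : 'M[T]_2) :
  A 0 0 = B 0 0 -> A 0 1 = B 0 1 -> A 1 0 = B 1 0 -> A 1 1 = B 1 1 -> A = B.
Proof.
move=> e1 e2 e3 e4; apply/matrixP => i j.
by have [->|->] := ord2P i; have [->|->] := ord2P j.
Qed.

Section Closed.
Variable C : numClosedFieldType.

Lemma gramM m n p (X : 'M[C]_(m, n)) (A : 'M[C]_(n, p)) : gram (X *m A) = A^t* *m gram X *m A.
Proof. by rewrite /gram adjmxM !mulmxA. Qed.

Lemma gram_adj m n (X : 'M[C]_(m, n)) : (gram X)^t* = gram X.
Proof. by rewrite /gram adjmxM trmxCK. Qed.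

Lemma gram_diag_ge0 m n (X : 'M[C]_(m, n)) i : 0 <= gram X i i.
Proof. by rewrite !mxE sumr_ge0 // => k _; rewrite !mxE mulrC mul_conjC_ge0. Qed.

Lemma gram_diagonalizable m n (X : 'M[C]_(m, n)) :
  exists2 U : 'M[C]_n, U \is unitarymx & exists d, gram (X *m U) = diag_mx d.
Proof.
have /orthomx_spectralP E : gram X \is normalmx by apply/normalmxP; rewrite gram_adj.
have Vu := spectral_unitarymx (gram X); have := unitarymxP Vu.
move: (spectralmx _) (spectral_diag _) E Vu => V d E Vu V1.
exists (V^t*); first by rewrite trmxC_unitary.
exists d; rewrite gramM E invmx_unitary // trmxCK !mulmxA V1 mul1mx.
by rewrite -mulmxA V1 mulmx1.
Qed.

Lemma unit_phase (z : C) : exists2 w : C, w^* * w = 1 & z * w \is Num.real.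
Proof.
have [->|z0] := eqVneq z 0; first by exists 1; rewrite ?conjC1 ?mulr1 ?mul0r ?rpred0.
have nz : `|z| != 0 by rewrite normr_eq0.
exists (z^* / `|z|); last by rewrite mulrA -normCK expr2 mulfK // normr_real.
by rewrite mulrC -normCK normrM normrV ?unitfE // norm_conjC normr_id divff // expr1n.
Qed.

Lemma sym2_phase_unitary (w : C) : w^* * w = 1 -> sym2 1 0 w \is unitarymx.
Proof.
move=> ww; apply/unitarymxP; apply/matrix2P; rewrite !mxE !big_ord_recl big_ord0 !mxE /=.
all: by rewrite ?conjC0 ?conjC1 ?(mul0r, mulr0, mulr1, addr0, add0r) // mulrC.
Qed.

(** [sym2 1 0 w] is [diag(1, w)]: a phase change of the second basis vector, which keeps a diagonal
    matrix diagonal. *)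
Lemma sym2_phase_conj (w : C) (M : 'M[C]_2) : w^* * w = 1 ->
  let N := (sym2 1 0 w)^t* *m M *m sym2 1 0 w in
  [/\ N 0 0 = M 0 0, N 0 1 = M 0 1 * w & N 1 1 = M 1 1].
Proof.
move=> ww N; rewrite /N; split.
all: rewrite !mxE !big_ord_recl !big_ord0 !mxE !big_ord_recl !big_ord0 !mxE /=.
all: rewrite ?conjC0 ?conjC1 ?(mul0r, mulr0, mulr1, mul1r, addr0, add0r) //.
- by rewrite lift0_ord2.
- by rewrite lift0_ord2 mulrAC ww mul1r.
Qed.

End Closed.

Section Real.
Variable R : realType.
Local Notation C := R[i].
Local Notation toC := (real_complex R).

Lemma real_complex_real (x : R) : toC x \is Num.real.
Proof. by apply/complex_realP; exists x. Qed.

Lemma conj_real_complex (x : R) : (toC x)^* = toC x.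
Proof. exact/conj_Creal/real_complex_real. Qed.

Lemma adj_real_complex m n (A : 'M[R]_(m, n)) : (map_mx toC A)^t* = map_mx toC A^T.
Proof. by apply/matrixP => i j; rewrite !mxE conj_real_complex. Qed.

Lemma hermitian2_real (M : 'M[C]_2) : M^t* = M -> M 0 1 \is Num.real ->
  M = map_mx toC (sym2 (complex.Re (M 0 0)) (complex.Re (M 0 1)) (complex.Re (M 1 1))).
Proof.
move=> Mh M01.
have h i j : (M j i)^* = M i j by rewrite -[in RHS]Mh !mxE.
apply/matrix2P; rewrite !mxE /=.
- by rewrite RRe_real //; apply/CrealP.
- by rewrite RRe_real.
- by rewrite -h RRe_real // (CrealP M01).
- by rewrite RRe_real //; apply/CrealP.
Qed.

Lemma gram_sym2_psd m (X : 'M[C]_(m, 2)) (a b d : R) :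
  gram X = map_mx toC (sym2 a b d) -> [/\ 0 <= a, 0 <= d & b ^+ 2 <= a * d].
Proof.
move=> XE.
have q (x y : R) : 0 <= a * x ^+ 2 + 2 * b * x * y + d * y ^+ 2.
  pose w : 'cV[R]_2 := \col_i if i == 0 then x else y.
  have := gram_diag_ge0 (X *m map_mx toC w) 0.
  rewrite gramM XE adj_real_complex -!map_mxM mxE ler0c => h.
  apply: le_trans h _; rewrite !mxE !big_ord_recl !big_ord0 !mxE !big_ord_recl !big_ord0 !mxE /=.
  by rewrite le_eqVlt; apply/orP; left; apply/eqP; ring.
have a0 : 0 <= a by have := q 1 0; rewrite expr0n expr1n /=; lra.
have d0 : 0 <= d by have := q 0 1; rewrite expr0n expr1n /=; lra.
split=> //.
(* The values are [d (a d - b^2)], [a (a d - b^2)] and, when [a = d = 0], [-2 b^2]; each settles one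
   case. *)
have h1 := q d (- b); have h2 := q b (- a); have h3 := q 1 (- b).
have [ap|] := ltrP 0 a.
  rewrite -(ler_pM2l ap) -subr_ge0; apply: le_trans h2 _.
  by rewrite le_eqVlt; apply/orP; left; apply/eqP; ring.
have [dp _|dz az] := ltrP 0 d.
  rewrite -(ler_pM2l dp) -subr_ge0; apply: le_trans h1 _.
  by rewrite le_eqVlt; apply/orP; left; apply/eqP; ring.
have za : a = 0 by apply/eqP; rewrite eq_le az a0.
have zd : d = 0 by apply/eqP; rewrite eq_le dz d0.
by rewrite za zd in h3 *; nra.
Qed.

(** The phase that makes the second matrix real leaves the first one diagonal, and the third is
    determined because the sum stays 1 under a unitary change of basis. *)
Lemma gram_normal_form m1 m2 m3 (X1 : 'M[C]_(m1, 2)) (X2 : 'M[C]_(m2, 2)) (X3 : 'M[C]_(m3, 2)) :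
  gram X1 + gram X2 + gram X3 = 1%:M ->
  exists2 U : 'M[C]_2, U \is unitarymx & exists p0 p1 a d r : R,
  [/\ gram (X1 *m U) = map_mx toC (sym2 p0 0 p1),
      gram (X2 *m U) = map_mx toC (sym2 a r d) &
      gram (X3 *m U) = map_mx toC (sym2 (1 - p0 - a) (- r) (1 - p1 - d))].
Proof.
move=> X1E.
have [U Uu [D DE]] := gram_diagonalizable X1.
have [w ww wr] := unit_phase (gram (X2 *m U) 0 1).
have Wu := sym2_phase_unitary ww.
have [P00 P01 P11] := sym2_phase_conj (gram (X1 *m U)) ww.
have [Q00 Q01 Q11] := sym2_phase_conj (gram (X2 *m U)) ww.
rewrite -!gramM -!mulmxA in P00 P01 P11 Q00 Q01 Q11.
set V := U *m _ in P00 P01 P11 Q00 Q01 Q11.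
have Vu : V \is unitarymx by apply: mul_unitarymx.
have P01' : gram (X1 *m V) 0 1 = 0 by rewrite P01 DE mxE /= mul0r.
exists V => //.
have PE := hermitian2_real (gram_adj (X1 *m V)); rewrite P01' in PE.
have QE := hermitian2_real (gram_adj (X2 *m V)); rewrite Q01 in QE.
have S : gram (X1 *m V) + gram (X2 *m V) + gram (X3 *m V) = 1%:M.
  by rewrite !gramM -!mulmxDl -!mulmxDr X1E mulmx1 unitarymx_adjmul.
move: {PE}(PE (rpred0 _)) {QE}(QE wr) => PE QE.
do 5 eexists; split; [exact: PE | exact: QE |].
have -> : gram (X3 *m V) = 1%:M - gram (X1 *m V) - gram (X2 *m V).
  rewrite -S; move: (gram (X1 *m V)) (gram (X2 *m V)) (gram (X3 *m V)) => A B D3.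
  by apply/matrixP => i j; rewrite !mxE; ring.
rewrite PE QE; apply/matrix2P; rewrite !mxE /= ?mulr1n ?mulr0n.
all: by rewrite ?rmorphB ?rmorphN ?rmorph0 ?rmorph1 ?subr0 ?sub0r.
Qed.
End Real.
End TwoByTwo.

(** * Two-column matrices and their row blocks *)

Section Columns.
Local Open Scope sesquilinear_scope.

Definition col2 (T : Type) m (A B : 'cV[T]_m) : 'M[T]_(m, 2) :=
  \matrix_(i, j) if j == 0 then A i 0 else B i 0.

(** Right multiplication by it extracts the first two columns. *)
Definition incl2 (T : pzSemiRingType) m : 'M[T]_(m, 2) := \matrix_(i, j) (i == j :> nat)%:R.

Lemma usubmx_col2 (T : Type) m p (A B : 'cV[T]_(m + p)) :
  usubmx (col2 A B) = col2 (usubmx A) (usubmx B).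
Proof. by apply/matrixP => i j; rewrite !mxE. Qed.

Lemma dsubmx_col2 (T : Type) m p (A B : 'cV[T]_(m + p)) :
  dsubmx (col2 A B) = col2 (dsubmx A) (dsubmx B).
Proof. by apply/matrixP => i j; rewrite !mxE. Qed.

Lemma mulmx_col2 (T : pzSemiRingType) m p (M : 'M[T]_(p, m)) (A B : 'cV[T]_m) :
  M *m col2 A B = col2 (M *m A) (M *m B).
Proof.
apply/matrixP => i j; rewrite !mxE; case: ifP => j0; apply: eq_bigr => k _; by rewrite mxE j0.
Qed.

Lemma mulmx_incl2 (T : pzSemiRingType) m p (M : 'M[T]_(p, m)) (m2 : (2 <= m)%N) i j :
  (M *m incl2 T m) i j = M i (widen_ord m2 j).
Proof.
rewrite mxE (bigD1 (widen_ord m2 j)) //= mxE eqxx mulr1 big1 ?addr0 // => k.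
by rewrite -val_eqE /= mxE => /negPf->; rewrite mulr0.
Qed.

Lemma incl2_mulmx_eq0 (T : pzSemiRingType) m p (M : 'M[T]_(2, p)) (i : 'I_m) j :
  (2 <= i)%N -> (incl2 T m *m M) i j = 0.
Proof.
move=> i2; rewrite mxE big1 // => k _; rewrite mxE.
have /negPf-> : (i : nat) != k by rewrite neq_ltn (leq_trans (ltn_ord k) i2) orbT.
by rewrite mul0r.
Qed.

Lemma gram_col_mx (C : numClosedFieldType) m p k (A : 'M[C]_(m, k)) (B : 'M[C]_(p, k)) :
  gram (col_mx A B) = gram A + gram B.
Proof. by rewrite /gram tr_col_mx map_row_mx mul_row_col. Qed.

Lemma gram_blocks (C : numClosedFieldType) m1 m2 m3 k (A : 'M[C]_(m1 + m2 + m3, k)) :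
  gram A = gram (usubmx (usubmx A)) + gram (dsubmx (usubmx A)) + gram (dsubmx A).
Proof. by rewrite -!gram_col_mx !vsubmxK. Qed.

Lemma gram_incl2 (C : numClosedFieldType) m (U : 'M[C]_m) : (2 <= m)%N -> U \is unitarymx ->
  gram (U *m incl2 C m) = 1%:M.
Proof.
move=> m2 Uu; rewrite gramM /gram unitarymx_adjmul // mulmx1.
apply/matrixP => i j; rewrite (mulmx_incl2 _ m2) !mxE /= rmorph_nat.
by rewrite -val_eqE eq_sym.
Qed.

Section RealColumns.
Variable R : realType.
Local Notation toC := (real_complex R).

Lemma ev_eq0 m k : (m <= k)%N -> ev R m k = 0.
Proof.
by move=> mk; apply/matrixP => i j; rewrite !mxE ltn_eqF // (leq_trans (ltn_ord i)).
Qed.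

(** For [m <= k] both sides are 0. *)
Lemma usubmx_ev m p k : usubmx (ev R (m + p) k) = ev R m k.
Proof. by apply/matrixP => i j; rewrite !mxE. Qed.

Lemma dsubmx_ev_lt m p k : (k < m)%N -> dsubmx (ev R (m + p) k) = 0.
Proof.
by move=> km; apply/matrixP => i j; rewrite !mxE /= gtn_eqF // ltn_addr.
Qed.

Lemma dsubmx_ev_ge m p k : (m <= k)%N -> dsubmx (ev R (m + p) k) = ev R p (k - m).
Proof.
by move=> mk; apply/matrixP => i j; rewrite !mxE /= -[in RHS](eqn_add2l m) subnKC.
Qed.

Lemma incl2_ev m : incl2 R m = col2 (ev R m 0) (ev R m 1).
Proof.
by apply/matrixP => i j; rewrite !mxE; have [->|->] := ord2P j.
Qed.

(** The matrix is the isometry [incl2] times the 2 by 2 matrix of coefficients, whose Gram matrix is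
    the result. *)
Lemma gram_real_col2 m (x y x' y' : R) : (2 <= m)%N ->
  gram (map_mx toC (col2 (x *: ev R m 0 + y *: ev R m 1) (x' *: ev R m 0 + y' *: ev R m 1)))
  = map_mx toC (sym2 (x ^+ 2 + y ^+ 2) (x * x' + y * y') (x' ^+ 2 + y' ^+ 2)).
Proof.
move=> m2; rewrite /gram adj_real_complex -map_mxM; congr (map_mx _ _).
have -> : col2 (x *: ev R m 0 + y *: ev R m 1) (x' *: ev R m 0 + y' *: ev R m 1)
   = incl2 R m *m (\matrix_(i, j) if j == 0 then if i == 0 then x else y
                               else if i == 0 then x' else y').
  apply/matrixP => i j; rewrite incl2_ev !mxE big_ord_recl big_ord1 !mxE /=.
  by case: ifP => _; rewrite mulrC [X in _ + X]mulrC.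
have EE : (incl2 R m)^T *m incl2 R m = 1%:M.
  by apply/matrixP => i j; rewrite (mulmx_incl2 _ m2) !mxE /= -val_eqE eq_sym.
rewrite trmx_mul -mulmxA (mulmxA _ (incl2 R m)) EE mul1mx.
apply/matrix2P; rewrite !mxE big_ord_recl big_ord1 !mxE /=; ring.
Qed.
End RealColumns.
End Columns.

(** * The double coset decomposition *)

Section Assembly.
Local Open Scope sesquilinear_scope.

Lemma unitaryE (C : numClosedFieldType) n (A : 'M[C]_n) : unitary A <-> A \is unitarymx.
Proof. by rewrite /unitary map_trmx; split => /unitarymxP. Qed.

Lemma block_diag_unitary (C : numClosedFieldType) m p (A : 'M[C]_m) (B : 'M[C]_p) :
  A \is unitarymx -> B \is unitarymx -> block_mx A 0 0 B \is unitarymx.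
Proof.
move=> Au Bu; apply/unitarymxP; rewrite tr_block_mx map_block_mx mulmx_block.
rewrite !trmx0 !map_mx0 !mulmx0 !mul0mx !addr0 add0r (unitarymxP Au) (unitarymxP Bu).
by rewrite -scalar_mx_block.
Qed.

(** Blocks of size at least 2 leave room for two distinct indices in each. *)
Lemma torus_indices n1 n2 n3 (n := (n1 + n2 + n3)%N) :
  (2 <= n1)%N -> (2 <= n2)%N -> (2 <= n3)%N ->
  [&& 0 < n, 1 < n, n1 < n, n1.+1 < n, n - 1 < n & n - 2 < n]%N
  /\ uniq [:: 0; 1; n1; n1.+1; n - 1; n - 2]%N.
Proof.
rewrite /n => n1_2 n2_2 n3_2; split; first by lia.
rewrite /= !inE !negb_or.
by do ![apply/andP; split]; lia.
Qed.

Section Main.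
Variables (R : realType).
Local Notation C := R[i].
Local Notation toC := (real_complex R).

Lemma inL_block_diag n1 n2 n3 (A : 'M[C]_n1) (B : 'M[C]_n2) (D : 'M[C]_n3) :
  A \is unitarymx -> B \is unitarymx -> D \is unitarymx ->
  inL (block_mx (block_mx A 0 0 B) 0 0 D).
Proof.
move=> Au Bu Du; split; first by apply/unitaryE; do 2?apply: block_diag_unitary.
have b1 (x : 'I_n1) : blk3 n1 n2 x = 0 by rewrite /blk3 ltn_ord.
have b2 (x : 'I_n2) : blk3 n1 n2 (n1 + x) = 1.
  by rewrite /blk3 ltnNge leq_addr /= ltn_add2l ltn_ord.
have b3 (x : 'I_n3) : blk3 n1 n2 (n1 + n2 + x) = 2.
  by rewrite /blk3 !ltnNge leq_addr -addnA leq_addr.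
move=> i j; case: (split_ordP i) => k ->; case: (split_ordP j) => l ->.
- rewrite block_mxEul; case: (split_ordP k) => {}k ->; case: (split_ordP l) => {}l ->.
  + by rewrite /= !b1.
  + by rewrite block_mxEur mxE.
  + by rewrite block_mxEdl mxE.
  + by rewrite /= !b2.
- by rewrite block_mxEur mxE.
- by rewrite block_mxEdl mxE.
- by rewrite /= !b3.
Qed.

(** The column version of [eq_gram_unitary], obtained by taking adjoints. *)
Lemma eq_gram_block m (X : 'M[C]_(m, 2)) (Y : 'M[C]_(m, 2)) :
  gram X = gram Y -> exists2 U : 'M[C]_m, U \is unitarymx & X = U *m Y.
Proof.
move=> XY; have [|U Uu E] := @eq_gram_unitary _ _ _ (X^t*) (Y^t*).
  by rewrite !trmxCK.
exists (U^t*); first by rewrite trmxC_unitary.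
by rewrite -[X]trmxCK E adjmxM trmxCK.
Qed.

Lemma eq_gram_inL n1 n2 n3 (X Y : 'M[C]_(n1 + n2 + n3, 2)) :
  gram (usubmx (usubmx X)) = gram (usubmx (usubmx Y)) ->
  gram (dsubmx (usubmx X)) = gram (dsubmx (usubmx Y)) ->
  gram (dsubmx X) = gram (dsubmx Y) ->
  exists2 l : 'M[C]_(n1 + n2 + n3), inL l & X = l *m Y.
Proof.
move=> /eq_gram_block[A Au EA] /eq_gram_block[B Bu EB] /eq_gram_block[D Du ED].
exists (block_mx (block_mx A 0 0 B) 0 0 D); first exact: inL_block_diag.
rewrite -[X]vsubmxK -[usubmx X]vsubmxK EA EB ED -[Y in RHS]vsubmxK -[usubmx Y in RHS]vsubmxK.
by rewrite !mul_block_col !mul0mx !addr0 !add0r.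
Qed.

Lemma real_unitary n (b : 'M[R]_n) : b^T *m b = 1%:M -> map_mx toC b \is unitarymx.
Proof.
move=> /mulmx1C bb; apply/unitarymxP.
by rewrite adj_real_complex -map_mxM bb map_mx1.
Qed.

Lemma inH_of_columns n (h : 'M[C]_n) (U : 'M[C]_2) : (2 <= n)%N ->
  h \is unitarymx -> U \is unitarymx -> h *m incl2 C n = incl2 C n *m U -> inH h.
Proof.
move=> n2 hu Uu hE; split; first exact/unitaryE.
(* By unitarity [h^t*] also preserves the span of the first two basis vectors; [low] applied to [h]
   and to [h^t*] then kills both off-diagonal blocks. *)
have hE' : h^t* *m incl2 C n = incl2 C n *m U^t*.
  rewrite -[LHS]mulmx1 -(unitarymxP Uu) mulmxA -(mulmxA _ (incl2 C n)) -hE.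
  by rewrite [(h^t*) *m _]mulmxA (unitarymx_adjmul erefl hu) mul1mx.
have low (M : 'M[C]_n) V (i j : 'I_n) : M *m incl2 C n = incl2 C n *m V ->
    (2 <= i)%N -> (j < 2)%N -> M i j = 0.
  move=> ME i2 j2; have := mulmx_incl2 M n2 i (Ordinal j2).
  rewrite ME incl2_mulmx_eq0 // => ->; congr (M _ _); exact/val_inj.
move=> i j; rewrite /blk2; case: ltnP => i2; case: ltnP => j2 // _.
  have := low _ _ j i hE' j2 i2; rewrite !mxE => /eqP; rewrite conjC_eq0 => /eqP.
  by [].
exact: low hE i2 j2.
Qed.

Lemma eq_columns_inH n (g f : 'M[C]_n) (U : 'M[C]_2) : (2 <= n)%N ->
  g \is unitarymx -> f \is unitarymx -> U \is unitarymx ->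
  g *m incl2 C n *m U = f *m incl2 C n -> exists2 h, inH h & g = f *m h.
Proof.
move=> n2 gu fu Uu gU; have Uu' : U^t* \is unitarymx by rewrite trmxC_unitary.
have gE : g *m incl2 C n = f *m incl2 C n *m U^t* by rewrite -gU (mulmxtVK _ Uu).
exists (f^t* *m g); last by rewrite mulmxA (unitarymxP fu) mul1mx.
have fu' : f^t* \is unitarymx by rewrite trmxC_unitary.
have hu := mul_unitarymx fu' gu.
apply: inH_of_columns n2 hu Uu' _.
by rewrite -mulmxA gE 2!mulmxA (unitarymx_adjmul erefl fu) mul1mx.
Qed.

Lemma Bset_torus_product n1 n2 n3 (b : 'M[R]_(n1 + n2 + n3)) :
  Bset b <-> exists s0 s1 r u v, b = torus_product (n1 + n2 + n3)
    0 1 n1 n1.+1 (n1 + n2 + n3 - 1) (n1 + n2 + n3 - 2) s0 s1 r u v.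
Proof.
split.
  move=> [x [y [z [[u _ [v _ <-]] [[r _ <-] [[s0 _ [s1 _ <-]] ->]]]]]].
  by exists s0, s1, r, u, v.
move=> [s0 [s1 [r [u [v ->]]]]].
do 3 eexists; split; [by exists u => //; exists v|split; [by exists r|split; [|reflexivity]]].
by exists s0 => //; exists s1.
Qed.

(** The angles make [X *m U] and [Y], the first two columns of [b], agree in all three block Gram
    matrices, which gives [l]. Then [g] and [l b] share their first two columns up to [U], which
    gives [h]. *)
Lemma cartan_decomposition n1 n2 n3 (g : 'M[C]_(n1 + n2 + n3)) :
  (2 <= n1)%N -> (2 <= n2)%N -> (2 <= n3)%N -> g \is unitarymx ->
  exists (l : 'M[C]_(n1 + n2 + n3)) (b : 'M[R]_(n1 + n2 + n3)) (h : 'M[C]_(n1 + n2 + n3)),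
    [/\ inL l, Bset b, inH h & g = l *m map_mx toC b *m h].
Proof.
move=> n1_2 n2_2 n3_2 gu; set n := (n1 + n2 + n3)%N in g gu *.
have n_2 : (2 <= n)%N by rewrite /n; lia.
have q0n1 : (n1 <= n - 1)%N by rewrite /n; lia.
have q1n1 : (n1 <= n - 2)%N by rewrite /n; lia.
have q0n2 : (n1 + n2 <= n - 1)%N by rewrite /n; lia.
have q1n2 : (n1 + n2 <= n - 2)%N by rewrite /n; lia.
have n1_0 : (0 < n1)%N by rewrite ltnW.
pose X := g *m incl2 C n.
have XG : gram X = 1%:M by apply: gram_incl2.
have [U Uu [p0 [p1 [a [d [r [G1 G2 G3]]]]]]] :=
  gram_normal_form (etrans (esym (gram_blocks X)) XG).
have [p0_ge0 p1_ge0 _] := gram_sym2_psd G1.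
have [a_ge0 d_ge0 rad] := gram_sym2_psd G2.
have [a'_ge0 d'_ge0] := gram_sym2_psd G3; rewrite sqrrN => rad'.
have [s0 [s1 [tr [tu [tv [e1 e2 e3 e4 e5]]]]]] :=
  torus_angles p0_ge0 p1_ge0 a_ge0 d_ge0 a'_ge0 d'_ge0 rad rad'.
have [lt_n uniq_n] := torus_indices n1_2 n2_2 n3_2.
have [bO b0 b1] :=
  @torus_product_columns R n 0 1 n1 n1.+1 (n - 1) (n - 2) lt_n uniq_n s0 s1 tr tu tv.
set b := torus_product _ _ _ _ _ _ _ _ _ _ _ _ in bO b0 b1.
pose Y := map_mx toC b *m incl2 C n.
have bu := real_unitary bO.
have YG : gram Y = 1%:M by apply: gram_incl2.
have YE : Y = map_mx toC (col2 (b *m ev R n 0) (b *m ev R n 1)).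
  rewrite -mulmx_col2 -incl2_ev map_mxM; congr (_ *m _).
  by apply/matrixP => i j; rewrite !mxE rmorph_nat.
(* Basis vectors with index at least [n1] vanish in the first block; the zero coefficients are kept
   to match [gram_real_col2]. *)
have Y1 : usubmx (usubmx Y) =
  map_mx toC (col2 (cos s0 *: ev R n1 0 + 0 *: ev R n1 1) (0 *: ev R n1 0 + cos s1 *: ev R n1 1)).
  rewrite YE -!map_usubmx !usubmx_col2 b0 b1; congr (map_mx _ (col2 _ _)).
    rewrite !(linearB, linearD, linearZ) /= !usubmx_ev (ev_eq0 _ q0n1) (ev_eq0 _ (leqnn n1)).
    by rewrite !(oppr0, scaler0, scale0r, addr0, add0r).
  rewrite !(linearB, linearD, linearZ) /= !usubmx_ev (ev_eq0 _ q0n1) (ev_eq0 _ (leqnn n1)).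
  by rewrite (ev_eq0 _ q1n1) (ev_eq0 _ (leqnSn n1)) !(oppr0, scaler0, scale0r, addr0, add0r).
have Y2 : dsubmx (usubmx Y) =
  map_mx toC (col2 ((- (sin s0 * sin tu)) *: ev R n2 0 + 0 *: ev R n2 1)
    ((- (sin s1 * (sin tr * cos tu))) *: ev R n2 0
     + (- (sin s1 * (cos tr * sin tv))) *: ev R n2 1)).
  rewrite YE -map_usubmx -map_dsubmx usubmx_col2 dsubmx_col2 b0 b1; congr (map_mx _ (col2 _ _)).
    set RHSv := (X in _ = X); rewrite !(linearB, linearD, linearZ) /= !usubmx_ev.
    rewrite (ev_eq0 _ q0n2) (dsubmx_ev_lt _ _ n1_0).
    rewrite (dsubmx_ev_ge _ _ (leqnn n1)) subnn.
by rewrite !(linear0, oppr0, scaler0, scale0r, addr0, add0r) /RHSv scale0r addr0 scalerN scaleNr.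
  set RHSv := (X in _ = X); rewrite !(linearB, linearD, linearZ) /= !usubmx_ev.
  rewrite (ev_eq0 _ q0n2) (ev_eq0 _ q1n2).
  rewrite (dsubmx_ev_lt _ _ n1_2) (dsubmx_ev_ge _ _ (leqnn n1)) (dsubmx_ev_ge _ _ (leqnSn n1)).
  by rewrite subnn subSnn !(linear0, oppr0, scaler0, scale0r, addr0, add0r) /RHSv !scalerN ?scaleNr.
have H1 : gram (usubmx (usubmx (X *m U))) = gram (usubmx (usubmx Y)).
  have -> : usubmx (usubmx (X *m U)) = usubmx (usubmx X) *m U by rewrite !mul_usub_mx.
  rewrite G1 Y1 gram_real_col2 // -e1 -e2.
  by congr (map_mx _ (sym2 _ _ _)); ring.
have H2 : gram (dsubmx (usubmx (X *m U))) = gram (dsubmx (usubmx Y)).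
  have -> : dsubmx (usubmx (X *m U)) = dsubmx (usubmx X) *m U.
    by rewrite mul_dsub_mx mul_usub_mx.
  rewrite G2 Y2 gram_real_col2 // -e3 -e4 -e5.
  by congr (map_mx _ (sym2 _ _ _)); ring.
(* Both triples of block Gram matrices have sum 1, so the third equality follows from the first
   two. *)
have H3 : gram (dsubmx (X *m U)) = gram (dsubmx Y).
  have XUG : gram (X *m U) = gram Y by rewrite gramM XG mulmx1 unitarymx_adjmul.
  apply: (@addrI _ (gram (usubmx (usubmx Y)) + gram (dsubmx (usubmx Y)))).
  by rewrite -gram_blocks -XUG gram_blocks H1 H2.
have [l lL XE] := eq_gram_inL H1 H2 H3.
have lu : l \is unitarymx by case: lL => /unitaryE.
have [|h hH gE] := eq_columns_inH n_2 gu (mul_unitarymx lu bu) Uu.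
  by rewrite -(mulmxA l).
exists l, b, h; split.
- exact: lL.
- by apply/Bset_torus_product; exists s0, s1, tr, tu, tv.
- exact: hH.
- exact: gE.
Qed.

Lemma cartan_product_unitary n1 n2 n3 (l : 'M[C]_(n1 + n2 + n3)) (b : 'M[R]_(n1 + n2 + n3)) h :
  (2 <= n1)%N -> (2 <= n2)%N -> (2 <= n3)%N -> inL l -> Bset b -> inH h ->
  l *m map_mx toC b *m h \is unitarymx.
Proof.
move=> n1_2 n2_2 n3_2 [/unitaryE lu _] /Bset_torus_product[s0 [s1 [r [u [v bE]]]]] [/unitaryE hu _].
have [lt_n uniq_n] := torus_indices n1_2 n2_2 n3_2.
have [bO _ _] := torus_product_columns lt_n uniq_n s0 s1 r u v.
rewrite -bE in bO.
exact: mul_unitarymx (mul_unitarymx lu (real_unitary bO)) hu.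
Qed.
End Main.
End Assembly.

(** The equivalence expresses both inclusions of [G = LBH], with [B] embedded entrywise into the
    complex matrices. *)
Theorem theorem4p1 (R : realType) (n1 n2 n3 : nat) :
  (2 <= n1)%N -> (2 <= n2)%N -> (2 <= n3)%N ->
  forall g : 'M[R[i]]_(n1 + n2 + n3),
    unitary g <->
    exists (l : 'M[R[i]]_(n1 + n2 + n3)) (b : 'M[R]_(n1 + n2 + n3))
           (h : 'M[R[i]]_(n1 + n2 + n3)),
      [/\ inL l, Bset b, inH h & g = l *m map_mx (real_complex R) b *m h].
Proof.
move=> n1_2 n2_2 n3_2 g; split=> [/unitaryE|[l [b [h [lL bB hH ->]]]]].
  exact: cartan_decomposition.
apply/unitaryE; exact: cartan_product_unitary.
Qed.
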